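(* Let $A\in\mathbf{M}_n(\mathbb{C})$. For any $\theta\in S^1=\mathbb{R}/(2\pi\mathbb{Z})$, one has $\mathcal{R}\mu_A(\theta)=\mu_{H(\theta)}$, where $H(\theta)=\frac12(e^{-i\theta}A+e^{i\theta}A^* )$.
   Context: For $M\in\mathbf{M}_n(\mathbb{C})$ (complex $n\times n$ matrices), the numerical measure $\mu_M$ is the image, under $x\mapsto\langle Mx,x\rangle$ (with $\langle x,y\rangle=y^*x$), of the normalized (probability) Euclidean surface measure on the unit sphere of $\mathbb{C}^n$; it is a Borel probability measure on $\mathbb{C}$, regarded as a measure on $\mathbb{R}$ when $M$ is Hermitian. The Radon transform of $\mu_A$ is the family $\{\mathcal{R}\mu_A(\theta)\}_{\theta\in S^1}$ of Borel measures on $\mathbb{R}$ defined by $(\mathcal{R}\mu_A(\theta))(I)=\mu_A(\{z\in\mathbb{C} : \mathrm{Re}(e^{-i\theta}z)\in I\})$ for every open set $I\subset\mathbb{R}$. *)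

(* Defs.v *)
From HB Require Import structures.
From mathcomp Require Import all_boot all_order all_algebra.
From mathcomp Require Import complex lra.
From mathcomp Require Import all_classical all_reals all_analysis.
From mathcomp Require Import measurable_realfun.

Set Implicit Arguments.
Unset Strict Implicit.
Unset Printing Implicit Defensive.

Import Order.TTheory GRing.Theory Num.Theory.
Import numFieldNormedType.Exports.

Local Open Scope classical_set_scope.
Local Open Scope complex_scope.
Local Open Scope sesquilinear_scope.
Local Open Scope ring_scope.

Local Notation Re := (@complex.Re _).
Local Notation Im := (@complex.Im _).

HB.instance Definition _ (R : realType) := PseudoPointedMetric.copy R[i] R[i]^o.
HB.instance Definition _ (R : realType) :=
  Measurable.copy R[i] (g_sigma_algebraType (@open R[i])).

Section borel_complex.
Context {R : realType}.

Lemma complex_ball (z : R[i]) (U : set R[i]) : open U -> U z ->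
  exists2 e : R, 0 < e &
    forall w, `|Re w - Re z| < e -> `|Im w - Im z| < e -> U w.
Proof.
move=> oU Uz.
have : nbhs z U by apply: open_nbhs_nbhs; split.
rewrite -nbhs_ballE => -[/= e e0 eU].
have [e0' Ime] : 0 < Re e /\ Im e = 0.
  by move: e0; rewrite /= ltcE /= => /andP[/eqP -> ->].
exists (Re e / 2); first by rewrite divr_gt0.
move=> w h1 h2; apply: eU.
suff : `|z - w| < e by [].
have -> : e = (Re e)%:C by case: (e) Ime => a b /= ->.
have -> : z - w = (Re z - Re w)%:C + (0 +i* (Im z - Im w)).
  by case: z w {Uz h1 h2} => [a b] [c d] /=; rewrite /real_complex_def; simpc.
rewrite (le_lt_trans (ler_normD _ _))// !normc_def /= expr0n/= !addr0 !add0r.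
rewrite !sqrtr_sqr ltcE /= addr0 eqxx /=.
by rewrite [Re e]splitr ltrD// distrC.
Qed.

Lemma measurable_Complex :
  measurable_fun [set: R * R] (fun p : R * R => p.1 +i* p.2).
Proof.
apply: (@measurability _ _ _ _ setT _ (@open R[i])) => //.
move=> _ [U oU <-]; rewrite setTI.
set P := _ @^-1` U.
pose I a b : set R := `]ratr a, ratr b[%classic.
pose box (t : (rat * rat) * (rat * rat)) := I t.1.1 t.1.2 `*` I t.2.1 t.2.2.
have -> : P = \bigcup_t (if `[< box t `<=` P >] then box t else set0).
  apply/seteqP; split => [[x y] Pxy|p [t _]]; last first.
    by case: asboolP => // bP; exact: bP.
  have [e e0 eU] := complex_ball oU Pxy.
  have /rat_in_itvoo[a] : x - e / 2 < x by rewrite ltrBlDr ltrDl divr_gt0.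
  have /rat_in_itvoo[b] : x < x + e / 2 by rewrite ltrDl divr_gt0.
  have /rat_in_itvoo[c] : y - e / 2 < y by rewrite ltrBlDr ltrDl divr_gt0.
  have /rat_in_itvoo[d] : y < y + e / 2 by rewrite ltrDl divr_gt0.
  rewrite !in_itv /= => /andP[d1 d2] /andP[c1 c2] /andP[b1 b2] /andP[a1 a2].
  exists ((a, b), (c, d)) => //; case: asboolP => [_|[]].
    by split; rewrite /I /= in_itv /=; apply/andP.
  have aux (u s t r : R) : u - e / 2 < r -> t < u + e / 2 ->
      r < s -> s < t -> `|s - u| < e.
    move=> h1 h2 h3 h4; rewrite ltr_norml.
    by apply/andP; split; lra.
  move=> [u v] [/=]; rewrite /I /= !in_itv /= => /andP[u1 u2] /andP[v1 v2].
  by apply: eU => /=; [exact: (aux _ _ _ _ a1 b2)|exact: (aux _ _ _ _ c1 d2)].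
apply: countable_bigcupT_measurable => // t.
by case: ifPn => // _; apply: measurableX; exact: measurable_itv.
Qed.

Lemma complex_open (V : set R[i]) :
  (forall z, V z -> exists2 e : R, 0 < e &
    forall w, `|Re w - Re z| < e -> `|Im w - Im z| < e -> V w) -> open V.
Proof.
move=> VP; rewrite openE => z /VP[e e0 eV].
apply/nbhs_ballP; exists e%:C; first by rewrite /= ltcE /= eqxx.
move=> w zw; have {}zw : `|z - w| < e%:C by [].
have zwE : z - w = (Re z - Re w) +i* (Im z - Im w).
  by case: z w {zw eV} => [a b] [c d]; simpc.
have : Num.sqrt ((Re z - Re w) ^+ 2 + (Im z - Im w) ^+ 2) < e.
  by move: zw; rewrite zwE normc_def /= ltcE /= eqxx.
move=> lte; apply: eV; rewrite distrC; apply: le_lt_trans lte.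
  by rewrite -sqrtr_sqr ler_wsqrtr// lerDl sqr_ge0.
by rewrite -sqrtr_sqr ler_wsqrtr// lerDr sqr_ge0.
Qed.

Let itv_nbhs (a b x : R) : a < x < b ->
  exists2 e, 0 < e & forall y, `|y - x| < e -> a < y < b.
Proof.
move=> /andP[ax xb]; exists (Num.min (x - a) (b - x)).
  by rewrite lt_min !subr_gt0 ax.
move=> y; rewrite lt_min => /andP[+ +]; rewrite ltr_norml => /andP[+ _].
rewrite ltr_norml => + /andP[_].
by rewrite opprB ltrBrDr subrK ltrD2r => -> ->.
Qed.

Lemma measurable_Re : measurable_fun [set: R[i]] (@complex.Re R).
Proof.
apply: (measurability _ (RGenOpens.measurableE R)) => //.
move=> _ [_ [a [b ->]] <-]; rewrite setTI; apply: sub_sigma_algebra.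
apply: complex_open => z /=; rewrite in_itv /= => /itv_nbhs[e e0 eab].
by exists e => // w + _; rewrite in_itv /=; exact: eab.
Qed.

Lemma measurable_Im : measurable_fun [set: R[i]] (@complex.Im R).
Proof.
apply: (measurability _ (RGenOpens.measurableE R)) => //.
move=> _ [_ [a [b ->]] <-]; rewrite setTI; apply: sub_sigma_algebra.
apply: complex_open => z /=; rewrite in_itv /= => /itv_nbhs[e e0 eab].
by exists e => // w _; rewrite in_itv /=; exact: eab.
Qed.

Lemma measurable_complexP d (T : measurableType d) (f : T -> R[i]) :
  measurable_fun setT (fun x => Re (f x)) ->
  measurable_fun setT (fun x => Im (f x)) -> measurable_fun setT f.
Proof.
move=> mR mI.
have -> : f = (fun p : R * R => p.1 +i* p.2) \o (fun x => (Re (f x), Im (f x))).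
  by apply/funext => x /=; case: (f x).
exact: (measurableT_comp measurable_Complex (measurable_fun_pair mR mI)).
Qed.

End borel_complex.

Section pushforward_sigma_finite.
Context d d' (T : measurableType d) (T' : measurableType d') (R : realType).

Lemma sigma_finite_pushforward (m : set T -> \bar R) (f : T -> T')
    (g : T' -> T) : measurable_fun setT g -> cancel f g ->
  sigma_finite setT m -> sigma_finite setT (pushforward m f).
Proof.
move=> mg fK [F TF Foo]; exists (fun i => g @^-1` F i).
  by rewrite -preimage_bigcup -TF preimage_setT.
move=> i; have [mF Fi] := Foo i; split.
  by rewrite -[X in measurable X]setTI; exact: mg.
by rewrite /pushforward -comp_preimage (_ : g \o f = id)//; exact/funext.
Qed.

Lemma sigma_finite_product (m : {sigma_finite_measure set T -> \bar R})
    (m' : {sigma_finite_measure set T' -> \bar R}) :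
  sigma_finite setT (m \x m')%E.
Proof.
have /sigma_finiteP[F [TF ndF Foo]] := sigma_finiteT m.
have /sigma_finiteP[G [TG ndG Goo]] := sigma_finiteT m'.
exists (fun n => F n `*` G n).
  rewrite -setXTT TF TG predeqE => -[x y]; split.
    move=> [/= [n _ Fnx] [k _ Gky]]; exists (maxn n k) => //; split.
    - by move: x Fnx; exact/subsetPset/ndF/leq_maxl.
    - by move: y Gky; exact/subsetPset/ndG/leq_maxr.
  by move=> [n _ []/= ? ?]; split; exists n.
move=> k; have [? ?] := Foo k; have [? ?] := Goo k.
split; first exact: measurableX.
by rewrite product_measure1E// lte_mul_pinfty// ge0_fin_numE.
Qed.

End pushforward_sigma_finite.

Section power_measure.
Context d (T : measurableType d) (R : realType).
Variable mu : {sigma_finite_measure set T -> \bar R}.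

Definition tcons n (p : T * n.-tuple T) : n.+1.-tuple T := [tuple of p.1 :: p.2].

Lemma measurable_tcons n : measurable_fun setT (@tcons n).
Proof. exact: measurable_cons. Qed.

Definition cons_measure n (m : {sigma_finite_measure set (n.-tuple T) -> \bar R})
  : set (n.+1.-tuple T) -> \bar R := pushforward (mu \x m)%E (@tcons n).

Section cons_measure.
Variables (n : nat) (m : {sigma_finite_measure set (n.-tuple T) -> \bar R}).

Let mtcons := @measurable_tcons n.

Let cons_measure0 : cons_measure m set0 = 0%E.
Proof. by rewrite /cons_measure /pushforward preimage_set0 measure0. Qed.

Let cons_measure_ge0 A : (0 <= cons_measure m A)%E.
Proof. exact: measure_ge0. Qed.

Let cons_measure_sigma_additive : semi_sigma_additive (cons_measure m).
Proof. exact: measure_semi_sigma_additive. Qed.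

HB.instance Definition _ := isMeasure.Build _ _ _ (cons_measure m)
  cons_measure0 cons_measure_ge0 cons_measure_sigma_additive.

Let cons_measure_sigma_finite : sigma_finite setT (cons_measure m).
Proof.
apply: (sigma_finite_pushforward
  (g := fun t : n.+1.-tuple T => (thead t, [tuple of behead t]))).
  apply: measurable_fun_pair; last exact: measurable_behead.
  exact: measurable_tnth.
  by move=> [x t]; rewrite /tcons /= theadE; congr pair; exact/val_inj.
exact: sigma_finite_product.
Qed.

HB.instance Definition _ := Measure_isSigmaFinite.Build _ _ _ (cons_measure m)
  cons_measure_sigma_finite.

End cons_measure.

Fixpoint power_measure n : {sigma_finite_measure set (n.-tuple T) -> \bar R} :=
  if n is n'.+1 then cons_measure (power_measure n') else dirac [tuple].

Lemma measurable_cube n (A : set T) : measurable A ->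
  measurable [set x : n.-tuple T | forall i, A (tnth x i)].
Proof.
move=> mA; rewrite (_ : mkset _ =
  \bigcap_(i in [set: 'I_n]) ((@tnth n T)^~ i @^-1` A)); last first.
  by apply/seteqP; split => x h i => //; [move=> _; exact: h|exact: h].
apply: fin_bigcap_measurable => // i _.
by rewrite -[X in measurable X]setTI; exact: measurable_tnth.
Qed.

Lemma power_measure_cube n (A : set T) : measurable A ->
  power_measure n [set x | forall i, A (tnth x i)] = (mu A ^+ n)%E.
Proof.
move=> mA; elim: n => [|n IHn].
  by rewrite /= /dirac indicE mem_set// => -[].
rewrite [power_measure _]/= expeS -IHn -product_measure1E//; last exact: measurable_cube.
rewrite /cons_measure /pushforward; congr ((_ \x _)%E _).
apply/seteqP; split => [[x t] h|[x t] [/= Ax At] i].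
  split => /= [|i]; first exact: (h ord0).
  by have := h (lift ord0 i); rewrite tnthS.
by case: (unliftP ord0 i) => [j|] ->; rewrite ?tnthS.
Qed.

Lemma power_measure_cons n (A : set T) : measurable A -> mu A = 0%E ->
  power_measure n.+1 [set x | A (thead x)] = 0%E.
Proof.
move=> mA A0; rewrite /= /cons_measure /pushforward.
rewrite (_ : _ @^-1` _ = A `*` setT).
  rewrite (_ : (_ \x _)%E _ = mu A * power_measure n setT)%E.
    by rewrite A0 mul0e.
  exact: product_measure1E.
by apply/seteqP; split => [[x t]|[x t]] //= []//.
Qed.

End power_measure.

Section lebesgue_complex.
Context {R : realType}.

(* planar Lebesgue measure, under the identification of R[i] with R * R *)
Definition lebesgue_complex : set R[i] -> \bar R :=
  pushforward (lebesgue_measure \x lebesgue_measure)%E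
    (fun p : R * R => p.1 +i* p.2).

Let mComplex := @measurable_Complex R.

Let lebesgue_complex0 : lebesgue_complex set0 = 0%E.
Proof. by rewrite /lebesgue_complex /pushforward preimage_set0 measure0. Qed.

Let lebesgue_complex_ge0 A : (0 <= lebesgue_complex A)%E.
Proof. exact: measure_ge0. Qed.

Let lebesgue_complex_sigma_additive : semi_sigma_additive lebesgue_complex.
Proof. exact: measure_semi_sigma_additive. Qed.

HB.instance Definition _ := isMeasure.Build _ _ _ lebesgue_complex
  lebesgue_complex0 lebesgue_complex_ge0 lebesgue_complex_sigma_additive.

Let lebesgue_complex_sigma_finite : sigma_finite setT lebesgue_complex.
Proof.
apply: (sigma_finite_pushforward (g := fun z => (Re z, Im z))).
  by apply: measurable_fun_pair; [exact: measurable_Re|exact: measurable_Im].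
  by case.
exact: (@sigma_finite_product _ _ _ _ R lebesgue_measure lebesgue_measure).
Qed.

HB.instance Definition _ := Measure_isSigmaFinite.Build _ _ _ lebesgue_complex
  lebesgue_complex_sigma_finite.

Definition square (a b : R) : set R[i] :=
  [set z | a <= Re z <= b /\ a <= Im z <= b].

Lemma measurable_square a b : measurable (square a b).
Proof.
rewrite (_ : square a b = (@complex.Re R @^-1` `[a, b]) `&`
  (@complex.Im R @^-1` `[a, b])); last first.
  by apply/seteqP; split => z; rewrite /square /= !in_itv.
apply: measurableI; rewrite -[X in measurable X]setTI.
  exact: measurable_Re.
exact: measurable_Im.
Qed.

Lemma lebesgue_complex_square a b : a < b ->
  lebesgue_complex (square a b) = ((b - a) ^+ 2)%:E.
Proof.
move=> ab; rewrite /lebesgue_complex /pushforward.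
rewrite (_ : _ @^-1` _ = `[a, b] `*` `[a, b]); last first.
  by apply/seteqP; split => z; rewrite /square /= !in_itv.
rewrite product_measure1E//= lebesgue_measure_itv/= lte_fin ab.
by rewrite -EFinB -EFinM expr2.
Qed.

Lemma lebesgue_complex_point : lebesgue_complex [set 0] = 0%E.
Proof.
rewrite /lebesgue_complex /pushforward.
rewrite (_ : _ @^-1` _ = [set 0] `*` [set 0]); last first.
  apply/seteqP; split => -[x y]; first by case.
  by case=> /= -> ->.
by rewrite product_measure1E//= lebesgue_measure_set1 mul0e.
Qed.

Definition lebesgue_complexn n : set (n.-tuple R[i]) -> \bar R :=
  power_measure lebesgue_complex n.

HB.instance Definition _ n := SigmaFiniteMeasure.on (@lebesgue_complexn n).
End lebesgue_complex.

Section complex_arithmetic.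
Context d (T : measurableType d) {R : realType}.
Implicit Types f g : T -> R[i].

Lemma measurable_complexD f g : measurable_fun setT f -> measurable_fun setT g ->
  measurable_fun setT (fun x => f x + g x).
Proof.
move=> mf mg; apply: measurable_complexP.
  rewrite (_ : (fun x => _) = (Re \o f) \+ (Re \o g)); last first.
    by apply/funext => x /=; case: (f x) (g x) => ? ? [].
  by apply: measurable_funD; apply: measurableT_comp => //; exact: measurable_Re.
rewrite (_ : (fun x => _) = (Im \o f) \+ (Im \o g)); last first.
  by apply/funext => x /=; case: (f x) (g x) => ? ? [].
by apply: measurable_funD; apply: measurableT_comp => //; exact: measurable_Im.
Qed.

Lemma measurable_complexM f g : measurable_fun setT f -> measurable_fun setT g ->
  measurable_fun setT (fun x => f x * g x).
Proof.
move=> mf mg; have mRf := measurableT_comp (@measurable_Re R) mf.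
have mIf := measurableT_comp (@measurable_Im R) mf.
have mRg := measurableT_comp (@measurable_Re R) mg.
have mIg := measurableT_comp (@measurable_Im R) mg.
apply: measurable_complexP.
  rewrite (_ : (fun x => _) =
      (Re \o f) \* (Re \o g) \- (Im \o f) \* (Im \o g)); last first.
    by apply/funext => x /=; case: (f x) (g x) => ? ? [].
  by apply: measurable_funB; exact: measurable_funM.
rewrite (_ : (fun x => _) =
    (Re \o f) \* (Im \o g) \+ (Im \o f) \* (Re \o g)); last first.
  by apply/funext => x /=; case: (f x) (g x) => ? ? [].
by apply: measurable_funD; exact: measurable_funM.
Qed.

Lemma measurable_complex_sum I (s : seq I) (h : I -> T -> R[i]) :
  (forall i, measurable_fun setT (h i)) ->
  measurable_fun setT (fun x => \sum_(i <- s) h i x).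
Proof.
move=> mh; elim: s => [|i s IHs].
  rewrite (_ : (fun x => _) = cst 0); first exact: measurable_cst.
  by apply/funext => x; rewrite big_nil.
rewrite (_ : (fun x => _) = (fun x => h i x + \sum_(j <- s) h j x)).
  exact: measurable_complexD.
by apply/funext => x; rewrite big_cons.
Qed.

Lemma measurable_complex_conj f : measurable_fun setT f ->
  measurable_fun setT (fun x => Num.conj (f x)).
Proof.
move=> mf; apply: measurable_complexP.
  rewrite (_ : (fun x => _) = Re \o f); last first.
    by apply/funext => x /=; case: (f x).
  by apply: measurableT_comp => //; exact: measurable_Re.
rewrite (_ : (fun x => _) = \- (Im \o f)); last first.
  by apply/funext => x /=; case: (f x).
by apply: measurable_funN; apply: measurableT_comp => //; exact: measurable_Im.
Qed.

Lemma measurable_real_complex (f : T -> R) : measurable_fun setT f ->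
  measurable_fun setT (fun x => (f x)%:C).
Proof. by move=> mf; apply: measurable_complexP => //=; exact: measurable_cst. Qed.

End complex_arithmetic.

Section hermitian_space.
Context {R : realType} (n : nat).
Implicit Types (x y : n.-tuple R[i]) (M : 'M[R[i]]_n).

(* the standard Hermitian product <x, y> = y^* x *)
Definition dotc (u v : 'cV[R[i]]_n) : R[i] := (v ^t* *m u) 0 0.

(* As a measurable space C^n is n.-tuple R[i]. *)
Definition cvec x : 'cV[R[i]]_n := \col_i tnth x i.

Definition vnorm x : R := Num.sqrt (Re (dotc (cvec x) (cvec x))).

Definition quad_form M x : R[i] := dotc (M *m cvec x) (cvec x).

Lemma measurable_quad_form M : measurable_fun setT (quad_form M).
Proof.
rewrite (_ : quad_form M = fun x =>
    \sum_i Num.conj (tnth x i) * \sum_j M i j * tnth x j); last first.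
  apply/funext => x; rewrite /quad_form /dotc mxE; apply: eq_bigr => i _.
  by rewrite !mxE; congr (_ * _); apply: eq_bigr => j _; rewrite !mxE.
apply: measurable_complex_sum => i; apply: measurable_complexM.
  by apply: measurable_complex_conj; exact: measurable_tnth.
apply: measurable_complex_sum => j; apply: measurable_complexM.
  exact: measurable_cst.
exact: measurable_tnth.
Qed.

HB.instance Definition _ M :=
  isMeasurableFun.Build _ _ _ _ (quad_form M) (measurable_quad_form M).

Lemma dotc_normE x : Re (dotc (cvec x) (cvec x)) =
  \sum_i (Re (tnth x i) ^+ 2 + Im (tnth x i) ^+ 2).
Proof.
have ReD : {morph (@complex.Re R) : z w / z + w} by move=> [? ?] [? ?].
rewrite /dotc mxE (big_morph _ ReD erefl); apply: eq_bigr => i _.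
rewrite !mxE; case: (tnth x i) => a b /=.
by rewrite mulNr opprK !expr2.
Qed.

Lemma dotc_norm_ge0 x : 0 <= Re (dotc (cvec x) (cvec x)).
Proof. by rewrite dotc_normE sumr_ge0// => i _; rewrite addr_ge0// sqr_ge0. Qed.

Lemma measurable_dotc_norm :
  measurable_fun setT (fun x => Re (dotc (cvec x) (cvec x))).
Proof.
rewrite (_ : (fun x => _) = Re \o quad_form 1%:M).
  exact: (measurableT_comp (@measurable_Re R) (measurable_quad_form _)).
by apply/funext => x; rewrite /quad_form /= mul1mx.
Qed.

Lemma measurable_vnorm : measurable_fun setT vnorm.
Proof.
rewrite (_ : vnorm = (@powR R ^~ 2^-1) \o
    (fun x => Re (dotc (cvec x) (cvec x)))).
  exact: (measurableT_comp (measurable_powR _) measurable_dotc_norm).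
by apply/funext => x; rewrite /= powR12_sqrt// dotc_norm_ge0.
Qed.

Definition unit_ball : set (n.-tuple R[i]) := [set x | vnorm x <= 1].

Definition unit_sphere : set (n.-tuple R[i]) := [set x | vnorm x = 1].

Lemma unit_ballE : unit_ball =
  [set x | \sum_i (Re (tnth x i) ^+ 2 + Im (tnth x i) ^+ 2) <= 1].
Proof.
apply/funext => x; rewrite /unit_ball /vnorm /= -dotc_normE.
by rewrite -{1}sqrtr1 ler_sqrt.
Qed.

Lemma measurable_unit_ball : measurable unit_ball.
Proof.
rewrite (_ : unit_ball =
    (fun x => Re (dotc (cvec x) (cvec x))) @^-1` `]-oo, 1]).
  by rewrite -[X in measurable X]setTI; exact: measurable_dotc_norm.
by rewrite unit_ballE; apply/funext => x /=; rewrite in_itv /= dotc_normE.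
Qed.

Lemma unit_ball_gt0 : (0 < lebesgue_complexn unit_ball)%E.
Proof.
pose b : R := (n.*2.+1%:R)^-1.
have b0 : 0 < b by rewrite invr_gt0 ltr0n.
apply: (@lt_le_trans _ _ (lebesgue_complexn
    [set x : n.-tuple R[i] | forall i, square 0 b (tnth x i)])).
  rewrite /lebesgue_complexn power_measure_cube; last exact: measurable_square.
  rewrite /= lebesgue_complex_square// subr0 -EFin_expe lte_fin.
  by rewrite !exprn_gt0.
apply: le_measure; rewrite ?inE.
- by apply: measurable_cube; exact: measurable_square.
- exact: measurable_unit_ball.
rewrite unit_ballE => x /= xb.
apply: (@le_trans _ _ (\sum_(i < n) (b ^+ 2 + b ^+ 2))).
  apply: ler_sum => i _; have [/andP[? ?] /andP[? ?]] := xb i.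
  by rewrite lerD// lerXn2r// nnegrE// ltW.
rewrite sumr_const card_ord -mulr2n -mulrnA -mulr_natl.
rewrite expr2 mulrA; apply: mulr_ile1.
- by rewrite mulr_ge0// ltW.
- exact: ltW.
- by rewrite /b ler_pdivrMr ?ltr0n// mul1r ler_nat mul2n.
- by rewrite /b invf_le1 ?ltr0n// ler1n.
Qed.

Let sqr_itv (a b : R) : a ^+ 2 + b ^+ 2 <= 1 -> -1 <= a <= 1.
Proof.
move=> ab1; rewrite -ler_norml -(@expr_le1 _ 2)// real_normK ?num_real//.
by apply: le_trans ab1; rewrite lerDl sqr_ge0.
Qed.

Lemma unit_ball_ltoo : (lebesgue_complexn unit_ball < +oo)%E.
Proof.
apply: (@le_lt_trans _ _ (lebesgue_complexn
    [set x : n.-tuple R[i] | forall i, square (-1) 1 (tnth x i)])).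
  apply: le_measure; rewrite ?inE.
  - exact: measurable_unit_ball.
  - by apply: measurable_cube; exact: measurable_square.
  rewrite unit_ballE => x /= x1 i.
  have {}x1 : Re (tnth x i) ^+ 2 + Im (tnth x i) ^+ 2 <= 1.
    apply: le_trans x1; rewrite (bigD1 i)//= lerDl sumr_ge0// => j _.
    by rewrite addr_ge0// sqr_ge0.
  by split; [exact: sqr_itv x1|move: x1; rewrite addrC; exact: sqr_itv].
rewrite /lebesgue_complexn power_measure_cube; last exact: measurable_square.
rewrite /= lebesgue_complex_square; last exact: lt_trans (ltrN10 _) ltr01.
by rewrite -EFin_expe ltry.
Qed.

Definition radial x : n.-tuple R[i] :=
  [tuple (vnorm x)^-1%:C * tnth x i | i < n].

Lemma measurable_radial : measurable_fun setT radial.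
Proof.
apply/measurable_fun_tnthP => i.
rewrite (_ : _ \o _ = fun x => (vnorm x)^-1%:C * tnth x i); last first.
  by apply/funext => x; rewrite /= tnth_mktuple.
apply: measurable_complexM; last exact: measurable_tnth.
apply: measurable_real_complex.
rewrite (_ : (fun x => _) = (@powR R ^~ (- 2^-1)) \o
    (fun x => Re (dotc (cvec x) (cvec x)))).
  exact: (measurableT_comp (measurable_powR _) measurable_dotc_norm).
by apply/funext => x; rewrite /= powRN powR12_sqrt// dotc_norm_ge0.
Qed.

(* The normalized surface measure of the unit sphere of C^n, as a measure on C^n
   carried by the sphere (sphere_measure_sphere). By polar coordinates, the
   surface measure of a Borel set E of unit vectors is 2n times the Lebesgue
   measure of the truncated cone {t x | 0 < t <= 1, x in E}; the factor 2n
   disappears in the normalization. The centre of the ball, sent to 0 by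
   radial, has measure 0 for n > 0. *)
Definition sphere_measure (E : set (n.-tuple R[i])) : \bar R :=
  ((fine (lebesgue_complexn unit_ball))^-1%:E *
   lebesgue_complexn (radial @^-1` E `&` unit_ball))%E.

Let c_ge0 : 0 <= (fine (lebesgue_complexn unit_ball))^-1.
Proof. by rewrite invr_ge0 fine_ge0. Qed.

Let mradial := measurable_radial.

Let push :=
  pushforward (mrestr (@lebesgue_complexn R n) measurable_unit_ball) radial.

Let push0 : push set0 = 0%E.
Proof. by rewrite /push /pushforward preimage_set0 measure0. Qed.

Let push_ge0 E : (0 <= push E)%E.
Proof. exact: measure_ge0. Qed.

Let push_sigma_additive : semi_sigma_additive push.
Proof. exact: measure_semi_sigma_additive. Qed.

HB.instance Definition _ :=
  isMeasure.Build _ _ _ push push0 push_ge0 push_sigma_additive.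

Let sphereE : sphere_measure = mscale (NngNum c_ge0) push.
Proof. by []. Qed.

Let sphere_measure0 : sphere_measure set0 = 0%E.
Proof. by rewrite sphereE measure0. Qed.

Let sphere_measure_ge0 E : (0 <= sphere_measure E)%E.
Proof. by rewrite mule_ge0// measure_ge0. Qed.

Let sphere_measure_sigma_additive : semi_sigma_additive sphere_measure.
Proof. rewrite sphereE; exact: measure_semi_sigma_additive. Qed.

HB.instance Definition _ := isMeasure.Build _ _ _ sphere_measure
  sphere_measure0 sphere_measure_ge0 sphere_measure_sigma_additive.

Let fin_ball : lebesgue_complexn unit_ball \is a fin_num.
Proof. by rewrite ge0_fin_numE// unit_ball_ltoo. Qed.

Let fine_ball : fine (lebesgue_complexn unit_ball) != 0.
Proof. by rewrite gt_eqF// fine_gt0// unit_ball_gt0 unit_ball_ltoo. Qed.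

Let sphere_measure1 : sphere_measure setT = 1%E.
Proof.
rewrite /sphere_measure preimage_setT setTI -[X in (_ * X)%E]fineK//.
by rewrite -EFinM mulVf.
Qed.

HB.instance Definition _ :=
  Measure_isProbability.Build _ _ _ sphere_measure sphere_measure1.


End hermitian_space.

Arguments unit_ball {R} n _.
Arguments unit_sphere {R} n _.
Arguments radial {R n} x.
Arguments sphere_measure {R} n E.

Lemma tuple_eq0P {R : realType} n (x : n.-tuple R[i]) : vnorm x = 0 ->
  forall i, tnth x i = 0.
Proof.
move=> /eqP; rewrite sqrtr_eq0 dotc_normE => x0 i; apply/eqP.
have h : \sum_i (Re (tnth x i) ^+ 2 + Im (tnth x i) ^+ 2) = 0.
  apply/eqP; rewrite eq_le x0 sumr_ge0// => j _.
  by rewrite addr_ge0// sqr_ge0.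
have /eqP : Re (tnth x i) ^+ 2 + Im (tnth x i) ^+ 2 = 0.
  by apply: (psumr_eq0P _ h) => // j _; rewrite addr_ge0// sqr_ge0.
by rewrite paddr_eq0 ?sqr_ge0// !sqrf_eq0 eq_complex.
Qed.

Lemma vnorm_radial {R : realType} n (x : n.-tuple R[i]) : vnorm x != 0 ->
  vnorm (radial x) = 1.
Proof.
move=> x0; have nx : 0 <= (vnorm x)^-1 by rewrite invr_ge0 sqrtr_ge0.
rewrite {1}/vnorm dotc_normE.
rewrite (eq_bigr (fun i => (vnorm x)^-1 ^+ 2 *
    (Re (tnth x i) ^+ 2 + Im (tnth x i) ^+ 2))); last first.
  move=> i _; rewrite tnth_mktuple; case: (tnth x i) => a b /=.
  by rewrite !mul0r subr0 addr0 !exprMn -mulrDr.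
rewrite -mulr_sumr -dotc_normE sqrtrM ?sqr_ge0// sqrtr_sqr ger0_norm//.
by rewrite mulVf.
Qed.

Lemma sphere_measure_sphere {R : realType} n : (0 < n)%N ->
  sphere_measure n (@unit_sphere R n) = 1%E.
Proof.
case: n => // n _.
rewrite -[RHS](@probability_setT _ _ _ (@sphere_measure R n.+1)).
rewrite /sphere_measure; congr (_ * _)%E.
set B := unit_ball n.+1; rewrite preimage_setT setTI.
have mS : measurable (radial @^-1` @unit_sphere R n.+1).
  rewrite -[X in measurable X]setTI; apply: measurable_radial => //.
  rewrite (_ : unit_sphere _ = @vnorm R n.+1 @^-1` [set 1])//.
  by rewrite -[X in measurable X]setTI; exact: measurable_vnorm.
have mB : measurable B by exact: measurable_unit_ball.
have mZ : measurable [set x : n.+1.-tuple R[i] | thead x = 0].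
  rewrite (_ : mkset _ = (@tnth n.+1 R[i])^~ ord0 @^-1` square 0 0).
    rewrite -[X in measurable X]setTI.
    by apply: measurable_tnth => //; exact: measurable_square.
  apply/seteqP; split => x; rewrite /square /= /thead.
    by move=> ->; rewrite lexx.
  by case: (tnth x ord0) => a b /= [/le_anti <- /le_anti <-].
have Z0 : lebesgue_complexn [set x : n.+1.-tuple R[i] | thead x = 0] = 0%E.
  apply: power_measure_cons lebesgue_complex_point.
  rewrite (_ : [set 0] = square 0 0); first exact: measurable_square.
  apply/seteqP; split => -[a b]; rewrite /square /=; last first.
    by case=> /le_anti <- /le_anti <-.
  by case=> -> ->; rewrite lexx.
have BS0 : lebesgue_complexn (B `\` (radial @^-1` @unit_sphere R n.+1)) = 0%E.
  apply/eqP; rewrite eq_le measure_ge0 andbT -[leRHS]Z0 le_measure ?inE//.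
    exact: measurableD.
  move=> x [_ /= xS]; apply: tuple_eq0P; apply/eqP/negP => /negP x0.
  by apply: xS; exact: vnorm_radial.
have := measureDI (@lebesgue_complexn R n.+1) mB mS.
by rewrite setIC => ->; rewrite [X in (X + _)%E](_ : _ = 0%E)// add0e.
Qed.

Section numerical_measure.
Context {R : realType} {n : nat}.
Implicit Types M A : 'M[R[i]]_n.

Definition numerical_measure M : set R[i] -> \bar R :=
  distribution (sphere_measure n) (quad_form M).

HB.instance Definition _ M := Probability.copy (numerical_measure M)
  (distribution (sphere_measure n) (quad_form M)).

End numerical_measure.

Section measures_on_the_line.
Context {R : realType}.
Implicit Types (mu : {measure set R[i] -> \bar R}) (theta : R).

(* A measure on C carried by the real axis, regarded as a measure on R; for
   numerical_measure M with M Hermitian no mass is lost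
   (numerical_measure_herm). *)
Definition on_real_line (mu : set R[i] -> \bar R) : set R -> \bar R :=
  fun B => mu (real_complex R @` B).

Lemma image_real_complex (B : set R) :
  real_complex R @` B = @complex.Re R @^-1` B `&` @complex.Im R @^-1` [set 0].
Proof.
apply/seteqP; split => [_ [x Bx <-]//|[x y] [/= Bx ->]]; by exists x.
Qed.

Lemma measurable_image_real_complex (B : set R) :
  measurable B -> measurable (real_complex R @` B).
Proof.
move=> mB; rewrite image_real_complex.
apply: measurableI; rewrite -[X in measurable X]setTI.
  exact: measurable_Re.
exact: measurable_Im.
Qed.

Section on_real_line.
Variable mu : {measure set R[i] -> \bar R}.

Let on_real_line0 : on_real_line mu set0 = 0%E.
Proof. by rewrite /on_real_line image_set0 measure0. Qed.

Let on_real_line_ge0 B : (0 <= on_real_line mu B)%E.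
Proof. exact: measure_ge0. Qed.

Let on_real_line_sigma_additive : semi_sigma_additive (on_real_line mu).
Proof.
move=> F mF tF mUF; rewrite /on_real_line image_bigcup.
apply: measure_semi_sigma_additive.
- by move=> i; exact: measurable_image_real_complex.
- apply/trivIsetP => i j _ _ ij.
  rewrite -subset0 => _ [[x Fx <-] [y Fy [yx]]].
  have /trivIsetP/(_ i j I I ij) Fij := tF.
  suff : (F i `&` F j) x by rewrite Fij.
  by split => //; rewrite -yx.
- by rewrite -image_bigcup; exact: measurable_image_real_complex.
Qed.

HB.instance Definition _ := isMeasure.Build _ _ _ (on_real_line mu)
  on_real_line0 on_real_line_ge0 on_real_line_sigma_additive.

End on_real_line.

(* e^(i theta). Points of R / 2 pi Z are represented by theta : R. *)
Definition expi theta : R[i] := cos theta +i* sin theta.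

Lemma expiD2pi theta : expi (theta + pi *+ 2) = expi theta.
Proof. by rewrite /expi cosD2pi sinD2pi. Qed.

Definition radon_proj theta (z : R[i]) : R := Re (expi (- theta) * z).

Lemma measurable_radon_proj theta : measurable_fun setT (radon_proj theta).
Proof.
apply: (measurableT_comp (@measurable_Re R)).
by apply: measurable_complexM; [exact: measurable_cst|exact: measurable_id].
Qed.

Definition radon_transform (mu : set R[i] -> \bar R) theta : set R -> \bar R :=
  pushforward mu (radon_proj theta).

Section radon_transform.
Variables (mu : {measure set R[i] -> \bar R}) (theta : R).
Let mproj := measurable_radon_proj theta.

Let radon_transform0 : radon_transform mu theta set0 = 0%E.
Proof. by rewrite /radon_transform /pushforward preimage_set0 measure0. Qed.

Let radon_transform_ge0 B : (0 <= radon_transform mu theta B)%E.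
Proof. exact: measure_ge0. Qed.

Let radon_transform_sigma_additive :
  semi_sigma_additive (radon_transform mu theta).
Proof. exact: measure_semi_sigma_additive. Qed.

HB.instance Definition _ := isMeasure.Build _ _ _ (radon_transform mu theta)
  radon_transform0 radon_transform_ge0 radon_transform_sigma_additive.

End radon_transform.
End measures_on_the_line.

Definition rotated_herm_part {R : realType} {n : nat} (A : 'M[R[i]]_n)
    (theta : R) : 'M[R[i]]_n :=
  2^-1 *: (expi (- theta) *: A + expi theta *: A ^t* ).

Lemma conj_expi {R : realType} (theta : R) :
  Num.conj (expi theta) = expi (- theta).
Proof. by rewrite /expi cosN sinN. Qed.

Lemma rotated_herm_part_herm {R : realType} n (A : 'M[R[i]]_n) (theta : R) :
  rotated_herm_part A theta \is hermsymmx.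
Proof.
apply/is_hermitianmxP; rewrite expr0 scale1r /rotated_herm_part.
apply/matrixP => i j; rewrite !mxE !rmorphM rmorphD !rmorphM/= fmorphV rmorph_nat.
rewrite conjCK !conj_expi opprK [in RHS]addrC.
by [].
Qed.

Lemma numerical_measure_herm {R : realType} n (M : 'M[R[i]]_n) :
  M \is hermsymmx -> on_real_line (numerical_measure M) setT = 1%E.
Proof.
move=> /is_hermitianmxP; rewrite expr0 scale1r => MH.
rewrite /on_real_line -[RHS](@probability_setT _ _ _ (sphere_measure n)).
rewrite /numerical_measure /distribution /pushforward; congr sphere_measure.
apply/seteqP; split => // x _; exists (Re (quad_form M x)) => //.
apply/eqP; rewrite eq_complex /= eqxx eq_sym /=.
suff h : Num.conj (quad_form M x) = quad_form M x.
  by rewrite -eqNr -[in X in _ == X]h; case: (quad_form M x).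
rewrite /quad_form /dotc.
set u := cvec x.
have -> : Num.conj ((u ^t* *m (M *m u)) 0 0) = ((u ^t* *m (M *m u)) ^t*) 0 0.
  by rewrite !mxE.
by rewrite !trmx_mul !map_mxM trmxCK -MH mulmxA.
Qed.

(* Main.v *)
(* <A^* x, x> is the conjugate of <A x, x>, so <H(theta) x, x> equals
   Re (e^(-i theta) <A x, x>) at every x: the two measures are images of the
   sphere measure under the same map. *)

Require Import Defs.
From mathcomp Require Import all_boot all_order all_algebra.
From mathcomp Require Import complex.
From mathcomp Require Import all_classical all_reals all_analysis.

Import GRing.Theory Num.Theory.

Local Open Scope classical_set_scope.
Local Open Scope ring_scope.
Local Open Scope complex_scope.
Local Open Scope sesquilinear_scope.

(** Put [w = expi (- theta) * quad_form A x]. By [quad_form_adjoint], the [A ^t*] summand of the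
    form of [rotated_herm_part A theta] contributes the conjugate of [w], so that form is the real
    number [Re w]. Both sides are then the sphere measure of the same set of vectors. *)

Lemma half_add_conj (R : realType) (w : R[i]) :
  2^-1 * (w + Num.conj w) = (complex.Re w)%:C.
Proof.
apply: (@mulfI _ 2); first by rewrite pnatr_eq0.
rewrite mulrA mulfV ?pnatr_eq0// mul1r mulr_natl mulr2n.
by case: w => a b; apply/eqP; rewrite eq_complex /= subrr addr0 !eqxx.
Qed.

Lemma quad_form_adjoint (R : realType) (n : nat) (M : 'M[R[i]]_n)
  (x : n.-tuple R[i]) : quad_form (M ^t*) x = Num.conj (quad_form M x).
Proof.
rewrite /quad_form /dotc; set u := cvec x.
(* A 1x1 matrix is its own transpose, so conjugating its entry amounts to taking the adjoint of the
   product. *)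
have -> : Num.conj ((u ^t* *m (M *m u)) 0 0) = ((u ^t* *m (M *m u)) ^t*) 0 0.
  by rewrite !mxE.
by rewrite !trmx_mul !map_mxM trmxCK mulmxA.
Qed.

Lemma quad_form_rotated_herm_part (R : realType) (n : nat) (A : 'M[R[i]]_n)
  (theta : R) (x : n.-tuple R[i]) :
  quad_form (rotated_herm_part A theta) x =
  (radon_proj theta (quad_form A x))%:C.
Proof.
have -> : quad_form (rotated_herm_part A theta) x =
    2^-1 * (expi (- theta) * quad_form A x +
            expi theta * quad_form (A ^t*) x).
  rewrite /quad_form /dotc /rotated_herm_part -scalemxAl mulmxDl -!scalemxAl.
  by rewrite -scalemxAr mulmxDr -!scalemxAr !mxE.
by rewrite quad_form_adjoint -half_add_conj rmorphM /= conj_expi opprK.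
Qed.

Theorem proposition4p1 (R : realType) (n : nat) (n_gt0 : (0 < n)%N)
    (A : 'M[R[i]]_n) (theta : R) (B : set R) (mB : measurable B) :
  radon_transform (numerical_measure A) theta B =
  on_real_line (numerical_measure (rotated_herm_part A theta)) B.
Proof.
rewrite /radon_transform /on_real_line /numerical_measure /distribution.
rewrite /pushforward; congr (sphere_measure n _).
(* The two preimages of [B] in C^n coincide pointwise; the converse inclusion uses injectivity of
   the embedding of R in C. *)
apply/seteqP; split=> x /=; rewrite quad_form_rotated_herm_part.
  by move=> Bx; exists (radon_proj theta (quad_form A x)).
by case=> r Br [<-].
Qed.
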